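(* A point $x^*\in X$ is a global (respectively, local) solution of the problem $$\min_{x\in X}\Big\{F(x)=f(x)+\sum_{i=1}^m h_i(g_i(x_i))\Big\}$$ if and only if $(x^*,g(x^* ))$ is a global (respectively, local) solution of the problem $$\min_{(x,z)\in\mathbb{R}^n\times\mathbb{R}^m}\Big\{\varphi(x,z)=\chi_\Omega(x,z)+f(x)+\sum_{i=1}^m h_i(z_i)\Big\}.$$
   Context: Setting. $n=\sum_{i=1}^m n_i$, and $x\in\mathbb{R}^n$ is written in blocks $x=(x_1,\dots,x_m)$ with $x_i\in\mathbb{R}^{n_i}$. $X\subset\mathbb{R}^n$ is a closed convex set. $f:\mathbb{R}^n\to\mathbb{R}$ is continuously differentiable (possibly nonconvex) with $L$-Lipschitz continuous gradient. For $i=1,\dots,m$, $g_i:\mathbb{R}^{n_i}\to\mathbb{R}$ is a continuous convex (possibly nonsmooth) function. For $i=1,\dots,m$, $h_i:D_i\to\mathbb{R}$ is concave and increasing (in the sense of nondecreasing), where $D_i\subset\mathbb{R}$ is an open interval, unbounded above, containing $g_i(x_i)$ for all $x\in X$; and the convex subdifferential satisfies $\partial(-h_i)(t)\subset(-\infty,0]$ whenever $t\ge g_i(x_i)$ for some $x\in X$. Notation. $g(x)=(g_1(x_1),\dots,g_m(x_m))\in\mathbb{R}^m$; $\Omega=\{(x,z)\in\mathbb{R}^n\times\mathbb{R}^m: x\in X,\ g_i(x_i)\le z_i,\ i=1,\dots,m\}$; $\chi_\Omega(x,z)=0$ if $(x,z)\in\Omega$ and $+\infty$ otherwise, so $\varphi=+\infty$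 outside $\Omega$. *)

(* Defs.v *)
From HB Require Import structures.
From mathcomp Require Import all_boot all_order all_algebra.
From mathcomp Require Import all_classical all_reals all_analysis.
Export numFieldNormedType.Exports.

Set Implicit Arguments.
Unset Strict Implicit.
Unset Printing Implicit Defensive.

Import Order.TTheory GRing.Theory Num.Theory.
Local Open Scope classical_set_scope.
Local Open Scope ring_scope.

(* The library norm on ['rV[R]_n] is the sup norm, so the Euclidean norm, with
   respect to which Lipschitz constants are measured, is defined here. *)
Definition enorm (R : realType) (n : nat) (v : 'rV[R]_n) : R :=
  Num.sqrt (\sum_(j < n) v 0 j ^+ 2).

Definition gradient (R : realType) (n : nat) (f : 'rV[R]_n -> R^o)
    (x : 'rV[R]_n) : 'rV[R]_n :=
  \row_(j < n) 'D_(delta_mx 0 j) f x.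

Definition continuously_differentiable (R : realType) (n : nat)
    (f : 'rV[R]_n -> R^o) : Prop :=
  (forall x, differentiable f x) /\ continuous (gradient f).

Definition lipschitz_gradient (R : realType) (n : nat) (L : R)
    (f : 'rV[R]_n -> R^o) : Prop :=
  forall x y, enorm (gradient f x - gradient f y) <= L * enorm (x - y).

Definition concave_function (R : realType) (A : set R) (phi : R -> R) : Prop :=
  convex_function (A : set (R^o : lmodType R)) (fun t => - phi t).

(* Convex subdifferential at [t] of a function with domain [A], i.e. of
   [phi] extended by +oo outside [A]; it is empty for [t] outside [A]. *)
Definition subdifferential (R : realType) (A : set R) (phi : R -> R) (t : R) :
    set R :=
  [set s | A t /\ forall u, A u -> phi t + s * (u - t) <= phi u].

(* Minimizers of [F] over [A]; the codomain of [F] is an arbitrary ordered type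
   so that both real and extended-real objectives are covered. *)
Definition global_solution (T : Type) (d : Order.disp_t) (V : porderType d)
    (A : set T) (F : T -> V) (x : T) : Prop :=
  A x /\ forall y, A y -> (F x <= F y)%O.

Definition local_solution (T : topologicalType) (d : Order.disp_t)
    (V : porderType d) (A : set T) (F : T -> V) (x : T) : Prop :=
  A x /\ \forall y \near x, A y -> (F x <= F y)%O.

Definition chi (R : realType) (T : Type) (A : set T) (p : T) : \bar R :=
  if p \in A then 0%E else +oo%E.

(* [submxrow x i : 'rV_(n_ i)] is the [i]-th block of
   [x : 'rV_(\sum_(i < m) n_ i)]. *)
Section problems.
Context (R : realType) (m : nat) (n_ : 'I_m -> nat).
Let n : nat := (\sum_(i < m) n_ i)%N.
Variables (X : set 'rV[R]_n) (f : 'rV[R]_n -> R)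
  (g : forall i : 'I_m, 'rV[R]_(n_ i) -> R) (h : 'I_m -> R -> R).

Definition gvec (x : 'rV[R]_n) : 'rV[R]_m := \row_(i < m) g (submxrow x i).

Definition F_obj (x : 'rV[R]_n) : R :=
  f x + \sum_(i < m) h i (g (submxrow x i)).

Definition Omega : set ('rV[R]_n * 'rV[R]_m) :=
  [set p : 'rV[R]_n * 'rV[R]_m | X p.1 /\ forall i : 'I_m, g (submxrow p.1 i) <= p.2 0 i].

(* [h i] is only meaningful on its domain [D i]; the values of the total
   function [h i] off [D i] are immaterial, being absorbed by [chi Omega]. *)
Definition varphi (p : 'rV[R]_n * 'rV[R]_m) : \bar R :=
  (chi R Omega p + (f p.1)%:E + \sum_(i < m) (h i (p.2 0 i))%:E)%E.

End problems.

(* Main.v *)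
Require Import Defs.
From mathcomp Require Import all_boot all_order all_algebra.
From mathcomp Require Import all_classical all_reals all_analysis.
Import Order.TTheory GRing.Theory Num.Theory.
Local Open Scope classical_set_scope.
Local Open Scope ring_scope.

(** Minimizing [varphi] over [z] for fixed [x] in [X] gives back [F]: each
    [h_i] is nondecreasing and feasibility reads [g_i (x_i) <= z_i], so the best
    [z] is [g x].  Hence [F x <= varphi (x, z)] for every [z]
    ([F_obj_le_varphi]; the feasible [z_i] do lie in the domain of [h_i], an
    interval without upper bound containing [g_i (x_i)]), with equality at
    [z = g x] ([varphi_gvec]), whereas [varphi] is [+oo] when [x] is not in [X].

    Equivalence of the solutions then only needs the two maps
    [x |-> (x, g x)] and [(x, z) |-> x], the second being a retraction of the
    first: a competitor of [x] is lifted by the first map, a competitor of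
    [(x, g x)] is projected by the second, and neither operation increases the
    objective ([global_solution_lift]).  In the local case competitors must in
    addition stay close to the reference point, which is continuity of the two
    maps ([local_solution_lift]); for the first map this is continuity of [g]
    ([continuous_gvec]). *)

Section lift_of_solutions.
Context {R : realType}.

(** [q] discards the auxiliary variables and [p] gives them optimal values, so
    that [F] is the partial minimization of [G]. *)
Lemma global_solution_lift {T U : Type} (X : set T) (F : T -> R)
    (G : U -> \bar R) (p : T -> U) (q : U -> T) (x : T) :
    q (p x) = x -> X x ->
    (forall y, X y -> G (p y) = (F y)%:E) ->
    (forall u, X (q u) -> ((F (q u))%:E <= G u)%E) ->
    (forall u, ~ X (q u) -> G u = +oo%E) ->
  global_solution X F x <-> global_solution setT G (p x).
Proof.
move=> qpx Xx Gp Gq Goo; split=> [[_ minF]|[_ minG]]; split=> //.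
  move=> u _; have [Xu|Xu] := pselect (X (q u)); last by rewrite (Goo u Xu) leey.
  by rewrite Gp//; apply: le_trans (Gq _ Xu); rewrite lee_fin; exact: minF.
by move=> y Xy; rewrite -lee_fin -!Gp//; exact: minG.
Qed.

Lemma local_solution_lift {T U : topologicalType} (X : set T) (F : T -> R)
    (G : U -> \bar R) (p : T -> U) (q : U -> T) (x : T) :
    p @ x --> p x -> q @ p x --> x ->
    q (p x) = x -> X x ->
    (forall y, X y -> G (p y) = (F y)%:E) ->
    (forall u, X (q u) -> ((F (q u))%:E <= G u)%E) ->
    (forall u, ~ X (q u) -> G u = +oo%E) ->
  local_solution X F x <-> local_solution setT G (p x).
Proof.
move=> p_cvg q_cvg qpx Xx Gp Gq Goo.
split=> [[_ minF]|[_ minG]]; split=> //.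
  have : \forall u \near p x, X (q u) -> F x <= F (q u) by exact: q_cvg minF.
  apply: filterS => u minFu _.
  have [Xu|Xu] := pselect (X (q u)); last by rewrite (Goo u Xu) leey.
  by rewrite Gp//; apply: le_trans (Gq _ Xu); rewrite lee_fin; exact: minFu.
have : \forall y \near x, setT (p y) -> (G (p x) <= G (p y))%E.
  exact: p_cvg minG.
apply: filterS => y minGy Xy.
by rewrite -lee_fin -!Gp//; exact: minGy.
Qed.

End lift_of_solutions.

(** A basic neighbourhood of a matrix constrains each entry separately, and the
    entries being finitely many, all constraints eventually hold at once. *)
Lemma cvg_mx {T : Type} {U : topologicalType} {m n : nat} (F : set_system T)
    (A : T -> 'M[U]_(m, n)) (M : 'M[U]_(m, n)) : Filter F ->
  (forall i j, (fun t => A t i j) @ F --> M i j) -> A @ F --> M.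
Proof.
move=> FF cvgA B [P nbhsP PB].
have : \forall t \near F, forall ij : 'I_m * 'I_n, P ij.1 ij.2 (A t ij.1 ij.2).
  by apply: filter_forall => ij; apply: cvgA; exact: nbhsP.
by apply: filterS => t Pt; apply: PB => i j; exact: (Pt (i, j)).
Qed.

Section epigraphical_reformulation.
Context {R : realType} {m : nat} {n_ : 'I_m -> nat}.
Local Notation n := (\sum_(i < m) n_ i)%N.

Lemma continuous_submxrow (i : 'I_m) :
  continuous (fun x : 'rV[R]_n => submxrow x i).
Proof.
move=> x; apply: (cvg_mx (nbhs x)) => k j.
have -> : (fun y : 'rV[R]_n => submxrow y i k j) =
    (fun y => y k (tagnat.Rank i j)) by apply/funext => y; rewrite mxE.
by rewrite mxE; exact: coord_continuous.
Qed.

Context (X : set 'rV[R]_n) (f : 'rV[R]_n -> R)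
  (g : forall i : 'I_m, 'rV[R]_(n_ i) -> R) (h : 'I_m -> R -> R).

Lemma continuous_gvec : (forall i, continuous (g i)) -> continuous (gvec g).
Proof.
move=> g_continuous x; apply: (cvg_mx (nbhs x)) => k i.
have -> : (fun y => gvec g y k i) = (fun y => g i (submxrow y i)).
  by apply/funext => y; rewrite mxE.
rewrite mxE; apply: (cvg_comp (fun y => submxrow y i) (g i)).
  exact: continuous_submxrow.
exact: g_continuous.
Qed.

Lemma varphi_feasible p : Omega X g p ->
  varphi X f g h p = (f p.1 + \sum_(i < m) h i (p.2 0 i))%:E.
Proof. by move=> Op; rewrite /varphi /chi mem_set// add0e sumEFin. Qed.

Lemma varphi_infeasible p : ~ Omega X g p -> varphi X f g h p = +oo%E.
Proof. by move=> Op; rewrite /varphi /chi memNset// sumEFin. Qed.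

Lemma varphi_gvec x : X x ->
  varphi X f g h (x, gvec g x) = (F_obj f g h x)%:E.
Proof.
move=> Xx; rewrite varphi_feasible /=; last first.
  by split=> //= i; rewrite mxE.
by congr (_ + _)%:E; apply: eq_bigr => i _; rewrite mxE.
Qed.

(** An infeasible point has value [+oo]; at a feasible one [z] dominates [g x]
    entrywise, and the monotonicity hypothesis compares the sums termwise. *)
Lemma F_obj_le_varphi p :
    (forall i t, g i (submxrow p.1 i) <= t ->
       h i (g i (submxrow p.1 i)) <= h i t) ->
  ((F_obj f g h p.1)%:E <= varphi X f g h p)%E.
Proof.
move=> h_le; have [Op|Op] := pselect (Omega X g p); last first.
  by rewrite varphi_infeasible// leey.
rewrite varphi_feasible// lee_fin lerD2l; apply: ler_sum => i _.
by apply: h_le; case: Op.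
Qed.

End epigraphical_reformulation.

Lemma unbounded_interval_upward_closed {R : realType} {D : set R} {s t : R} :
  is_interval D -> ~ has_ubound D -> D s -> s <= t -> D t.
Proof.
move=> itvD /has_ubPn/(_ t)[u Du tu] Ds st.
by apply: (itvD s u) => //; rewrite st ltW.
Qed.

Theorem proposition1 (R : realType) (m : nat) (n_ : 'I_m -> nat)
    (X : set 'rV[R]_(\sum_(i < m) n_ i)%N)
    (f : 'rV[R]_(\sum_(i < m) n_ i)%N -> R) (L : R)
    (g : forall i : 'I_m, 'rV[R]_(n_ i) -> R)
    (D : 'I_m -> set R) (h : 'I_m -> R -> R)
    (X_closed : closed X)
    (X_convex : convex_set X)
    (f_C1 : continuously_differentiable f)
    (f_lip : lipschitz_gradient L f)
    (g_continuous : forall i : 'I_m, continuous (g i))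
    (g_convex : forall i : 'I_m, convex_function setT (g i))
    (D_interval : forall i : 'I_m, is_interval (D i))
    (D_open : forall i : 'I_m, open (D i))
    (D_unbounded : forall i : 'I_m, ~ has_ubound (D i))
    (D_g : forall (i : 'I_m) x, X x -> D i (g i (submxrow x i)))
    (h_concave : forall i : 'I_m, concave_function (D i) (h i))
    (h_increasing : forall i : 'I_m, {in D i &, {homo h i : s t / s <= t}})
    (h_subdiff : forall (i : 'I_m) (t : R),
       (exists2 x, X x & g i (submxrow x i) <= t) ->
       subdifferential (D i) (fun u => - h i u) t `<=` [set s | s <= 0])
    (x : 'rV[R]_(\sum_(i < m) n_ i)%N) (Xx : X x) :
  (global_solution X (F_obj f g h) x <->
   global_solution setT (varphi X f g h) (x, gvec g x)) /\
  (local_solution X (F_obj f g h) x <->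
   local_solution setT (varphi X f g h) (x, gvec g x)).
Proof.
have h_le i t y : X y -> g i (submxrow y i) <= t ->
    h i (g i (submxrow y i)) <= h i t.
  move=> Xy gt; have Dg := D_g i _ Xy.
  by apply: h_increasing => //; apply: mem_set => //;
    exact: unbounded_interval_upward_closed (D_unbounded i) Dg gt.
have le_varphi p : X p.1 -> ((F_obj f g h p.1)%:E <= varphi X f g h p)%E.
  by move=> Xp; apply: F_obj_le_varphi => i t; exact: h_le.
have varphi_oo p : ~ X p.1 -> varphi X f g h p = +oo%E.
  by move=> Xp; apply: varphi_infeasible => -[].
have lift_eq y : X y -> varphi X f g h (y, gvec g y) = (F_obj f g h y)%:E.
  exact: varphi_gvec.
split.
  exact: (global_solution_lift _ _ _ (fun y => (y, gvec g y)) fst).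
apply: (local_solution_lift _ _ _ (fun y => (y, gvec g y)) fst) => //.
  by apply: (@cvg_pair _ _ _ (nbhs x) (nbhs x) (nbhs (gvec g x)));
    [exact: cvg_id|exact: continuous_gvec].
exact: cvg_fst.
Qed.
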